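(* Let $(E_n,\tau_n)_{n\in\mathbb{N}}$ be a sequence of Hausdorff locally convex spaces over $\mathbb{K}$ such that, for each $n$, $E_n\subset E_{n+1}$ is a linear subspace and the inclusion $(E_n,\tau_n)\to(E_{n+1},\tau_{n+1})$ is continuous. Let $E=\bigcup_{n\in\mathbb{N}}E_n$ carry the locally convex inductive limit topology $\tau_{ind}$. Suppose that each $(E_n,\tau_n)$ is strictly webbed. (a) If $(E,\tau_{ind})$ is quasi-locally Baire, then $(E,\tau_{ind})$ is regular. (b) If each $(E_n,\tau_n)$ is quasi-locally Baire and $(E,\tau_{ind})$ is regular, then $(E,\tau_{ind})$ is locally Baire.
   Context: Throughout, $\mathbb{K}=\mathbb{R}$ or $\mathbb{C}$, and ''space'' means a Hausdorff locally convex space over $\mathbb{K}$. Disks. A disk is a convex, balanced set. For a disk $B$ in a space $E$, $E_B$ denotes the linear span of $B$, equipped with the Minkowski functional (gauge) of $B$. If $B$ is bounded, this functional is a norm $\|\cdot\|_B$ on $E_B$. A bounded disk $B$ is a Baire disk if the normed space $(E_B,\|\cdot\|_B)$ is a Baire space. For a locally convex topology $\rho$ on $E$, a $\rho$-Baire disk is a Baire disk of $(E,\rho)$; in particular it is $\rho$-bounded. Locally Baire. A space $E$ is locally Baire if every bounded subset of $E$ is contained in a Baire disk of $E$. Quasi-locally Baire. A space $(E,\tau)$ is quasi-locally Baire if for every bounded subset $A$ of $(E,\tau)$ there is a (Hausdorff) locally convex topology $\rho$ on $E$, coarser than (or equal to) $\tau$ and possibly depending on $A$, such that $A$ is contained in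 a $\rho$-Baire disk. Inductive limit. $\tau_{ind}$ is the finest locally convex topology on $E=\bigcup_n E_n$ making all inclusions $(E_n,\tau_n)\to E$ continuous. Regular. $(E,\tau_{ind})$ is regular if for every bounded subset $A$ of $(E,\tau_{ind})$ there is $m\in\mathbb{N}$ such that $A\subset E_m$ and $A$ is bounded in $(E_m,\tau_m)$. Strictly webbed (absolutely convex webs). A web on a space $E$ is a family of absolutely convex sets $W_{n_1,\dots,n_k}\subset E$, indexed by all finite sequences of positive integers ($k\ge 1$), such that: $\bigcup_{n}W_n$ absorbs each point of $E$; $W_{n_1,\dots,n_k,n}\subset\frac12 W_{n_1,\dots,n_k}$ for all $n$; and $\bigcup_n W_{n_1,\dots,n_k,n}$ absorbs each point of $W_{n_1,\dots,n_k}$. The sets with $k$ indices form the $k$th layer. A strand is a sequence $(W_k)_{k\ge1}$ of the form $W_k=W_{n_1,\dots,n_k}$ for some sequence $(n_i)_{i\ge 1}$ of positive integers. The web is compatible with the topology of $E$ if for every strand $(W_k)$ and every neighbourhood $U$ of $0$ there is $k$ with $W_k\subset U$. The web is strict if it is compatible and, for every strand $(W_k)$ and every choice of $x_k\in W_k$, the series $\sum_k x_k$ converges in $E$ and $\sum_{k=n+1}^\infty x_k\in W_n$ for every $n\ge 1$. A space is strictly webbed if it admits a strict web. *)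

(* Defs.v *)
From HB Require Import structures.
From mathcomp Require Import all_boot all_order all_algebra.
From mathcomp Require Import complex.
From mathcomp Require Import all_classical all_reals all_analysis.

Set Implicit Arguments.
Unset Strict Implicit.
Unset Printing Implicit Defensive.

Import Order.TTheory GRing.Theory Num.Theory.
Import numFieldNormedType.Exports.

Local Open Scope classical_set_scope.
Local Open Scope ring_scope.

Variant scalar_kind := RealScalars | ComplexScalars.

Definition scalars (R : realType) (k : scalar_kind) : numFieldType :=
  match k with
  | RealScalars => R
  | ComplexScalars => R[i]
  end.

Definition of_real (R : realType) (k : scalar_kind) : R -> scalars R k :=
  match k with
  | RealScalars => fun t => t
  | ComplexScalars => fun t => (t%:C)%C
  end.

Definition baire_space (T : topologicalType) : Prop :=
  forall F : nat -> set T,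
    (forall n, open (F n) /\ dense (F n)) -> dense (\bigcap_n F n).

Section LocallyConvex.
Variables (R : realType) (k : scalar_kind).
Local Notation K := (scalars R k).

(* In the order of R[i], [0 < r] forces [r] to be real, so [r] below is a
   positive real number for both kinds of scalars. *)
Definition absorbs (E : lmodType K) (U A : set E) : Prop :=
  exists2 r : K, 0 < r &
    forall a : K, r <= `|a| -> A `<=` [set a *: u | u in U].

Definition tvs_bounded (E : tvsType K) (A : set E) : Prop :=
  forall U : set E, nbhs (0 : E) U -> absorbs U A.

Definition balanced (E : lmodType K) (B : set E) : Prop :=
  forall (a : K) (x : E), `|a| <= 1 -> B x -> B (a *: x).

Definition disk (E : lmodType K) (B : set E) : Prop :=
  convex_set B /\ balanced B.

Definition lin_span (E : lmodType K) (B : set E) : set E :=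
  [set x | exists (n : nat) (a : 'I_n -> K) (b : 'I_n -> E),
      (forall i, B (b i)) /\ x = \sum_i a i *: b i].

Definition gauge (E : lmodType K) (B : set E) (x : E) : R :=
  inf [set t : R | 0 < t /\ [set of_real k t *: b | b in B] x].

(* The normed space (E_B, ||.||_B) is presented as a normed module [N] with a
   linear injection into [E] whose range is the span of [B] and which carries
   the norm of [N] to the gauge of [B]; this determines [N] up to isometric
   isomorphism. *)
Definition baire_disk (E : tvsType K) (B : set E) : Prop :=
  [/\ disk B, tvs_bounded B &
      exists (N : normedModType K) (f : {linear N -> E}),
        [/\ injective f,
            range f = lin_span B,
            (forall x : N, `|x| = of_real k (gauge B (f x))) &
            baire_space N]].

(* A locally convex topology on the vector space [E], not necessarily
   Hausdorff: a locally convex space together with a linear bijection from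
   [E], along which the topology is transported.  [lct_id] plays the role of
   the identity map of [E]. *)
Record lc_topology (E : lmodType K) := LcTopology {
  lct_space : tvsType K;
  lct_id : {linear E -> lct_space};
  lct_bij : bijective lct_id }.

Definition coarser (E : tvsType K) (rho : lc_topology E) : Prop :=
  continuous (lct_id rho : E -> lct_space rho).

(* [tvsType] does not include the Hausdorff axiom, and an inductive limit of
   Hausdorff spaces may fail it, so it is part of the next two notions. *)
Definition locally_baire (E : tvsType K) : Prop :=
  hausdorff_space E /\
  forall A : set E, tvs_bounded A ->
    exists2 B : set E, baire_disk B & A `<=` B.

Definition quasi_locally_baire (E : tvsType K) : Prop :=
  hausdorff_space E /\
  forall A : set E, tvs_bounded A ->
    exists rho : lc_topology E,
      [/\ hausdorff_space (lct_space rho), coarser rho &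
          exists2 B : set (lct_space rho),
            baire_disk B & [set lct_id rho x | x in A] `<=` B].

(* Indices range over [nat] instead of the positive integers.  [W s] is a web
   set of layer [size s]; the value [W [::]] is irrelevant. *)
Definition web (E : lmodType K) (W : seq nat -> set E) : Prop :=
  [/\ (forall s, s != [::] -> disk (W s)),
      (forall x : E, absorbs (\bigcup_n W [:: n]) [set x]),
      (forall s n, s != [::] ->
         W (rcons s n) `<=` [set 2^-1 *: y | y in W s]) &
      (forall s, s != [::] -> forall x, W s x ->
         absorbs (\bigcup_n W (rcons s n)) [set x])].

Definition strand (E : lmodType K) (W : seq nat -> set E) (u : nat -> nat)
  (m : nat) : set E := W (mkseq u m).

Definition compatible_web (E : tvsType K) (W : seq nat -> set E) : Prop :=
  forall (u : nat -> nat) (U : set E), nbhs (0 : E) U ->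
    exists2 m : nat, (1 <= m)%N & strand W u m `<=` U.

Definition strict_web (E : tvsType K) (W : seq nat -> set E) : Prop :=
  [/\ web W, compatible_web W &
      forall (u : nat -> nat) (x : nat -> E),
        (forall m, (1 <= m)%N -> strand W u m (x m)) ->
        (exists l : E, (\sum_(1 <= m < N) x m) @[N --> \oo] --> l) /\
        (forall n, (1 <= n)%N ->
           exists2 l : E, (\sum_(n.+1 <= m < N) x m) @[N --> \oo] --> l &
             strand W u n l)].

Definition strictly_webbed (E : tvsType K) : Prop :=
  exists W : seq nat -> set E, strict_web W.

Definition inductive_limit_topology (En : nat -> tvsType K) (E : tvsType K)
    (j : forall n, {linear En n -> E}) : Prop :=
  (forall n, continuous (j n)) /\
  forall sigma : lc_topology E,
    (forall n, continuous (lct_id sigma \o j n)) -> coarser sigma.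

Definition regular_limit (En : nat -> tvsType K) (E : tvsType K)
    (j : forall n, {linear En n -> E}) : Prop :=
  forall A : set E, tvs_bounded A ->
    exists m : nat, A `<=` range (j m) /\ tvs_bounded (j m @^-1` A).

End LocallyConvex.

(* Main.v *)
From HB Require Import structures.
Require Import Defs.
From mathcomp Require Import all_boot all_order all_algebra.
From mathcomp Require Import complex.
From mathcomp Require Import all_classical all_reals all_analysis.

(** Both parts rest on De Wilde's localization argument (lemma [localization]).
    Let [N] be a Baire normed space, [G] a Hausdorff space, [f : N -> G] linear
    and continuous, and suppose that the range of [f] is covered by countably
    many strictly webbed spaces [V n] mapped continuously into [G].  Then [f]
    factors continuously through a single [V m].  By Baire, the preimage in [N]
    of some [V m] is not meager; since each web set is absorbed by the union of
    its successors, a strand of the web of [V m] can be chosen all of whose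
    preimages are not meager.  These preimages are disks, so their closures are
    neighbourhoods of 0 in [N].  A point [x] of a small ball is then written as
    the sum of a series whose [i]-th term lies in the preimage of the [i]-th set
    of the strand; strictness of the web makes the lifted series converge in
    [V m], inside a prescribed web set, and as [G] is Hausdorff its sum lies
    over [f x].  Compatibility of the web turns this into continuity at 0.

    Applied to the normed space [N] spanned by a Baire disk [B] of [G], this
    says that [B] lies in a single [V m] and is bounded there
    ([baire_disk_localized]).  For (a), [G] is [E] with the coarser topology
    [rho] furnished by quasi-local Baireness, and [V n] is [E_n].  For (b),
    regularity places a bounded set in some [E_m]; then [G] is [E_m] with its
    coarser topology and every [V n] is [E_m] itself, so that the Baire disk
    found for [rho] is bounded for the original topology of [E_m], hence in [E],
    while its normed space is unchanged.  Separation of [E] in (b) is itself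
    a consequence of regularity: the closure of 0 is a bounded subspace, so it
    is a bounded subspace of the Hausdorff space [E_m], which is trivial. *)

Set Implicit Arguments.
Unset Strict Implicit.
Unset Printing Implicit Defensive.

Import Order.TTheory GRing.Theory Num.Theory.
Import numFieldNormedType.Exports.

Local Open Scope classical_set_scope.
Local Open Scope ring_scope.

(** * Meager sets *)

Section Meager.
Variable T : topologicalType.
Implicit Types X Y : set T.

(** Stated through the complement, as a countable intersection of dense open
    sets, so that it plugs directly into [baire_space]. *)
Definition meager X : Prop := exists F : nat -> set T,
  (forall n, open (F n) /\ dense (F n)) /\ \bigcap_n F n `<=` ~` X.

Lemma meager_sub X Y : X `<=` Y -> meager Y -> meager X.
Proof. by move=> XY [F [oF FY]]; exists F; split=> // x /FY nYx /XY. Qed.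

Lemma nonmeager_nonempty X : ~ meager X -> X !=set0.
Proof.
move=> nX; apply: contrapT => X0; apply: nX; exists (fun _ => setT).
split=> [_|x _ Xx]; last by apply: X0; exists x.
by split=> [|O [x Ox] _]; [exact: openT|exists x].
Qed.

Lemma meager_bigcup (I : countType) (X : I -> set T) :
  (forall i, meager (X i)) -> meager (\bigcup_i X i).
Proof.
move=> /choice[F FP].
pose G p := if @unpickle (I * nat)%type p is Some q then F q.1 q.2 else setT.
exists G; split=> [p|x Gx [i _ Xix]].
  rewrite /G; case: unpickle => [q|]; first by have [/(_ q.2)] := FP q.1.
  split; first exact: openT.
  by move=> O [x Ox] _; exists x.
have [_ /(_ x)] := FP i; apply=> // m _.
by have := Gx (pickle (i, m)) Logic.I; rewrite /G pickleK.
Qed.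

Lemma meager_preimage (g h : T -> T) X : continuous g -> continuous h ->
  cancel g h -> cancel h g -> meager X -> meager (g @^-1` X).
Proof.
move=> cg ch gK hK [F [FP FX]]; exists (fun n => g @^-1` F n); split=> [n|x Fx].
  have [oF dF] := FP n; split; first by move/continuousP: cg; apply.
  move=> O [x Ox] oO.
  have [||y [Oy Fy]] := dF (h @^-1` O).
  - by exists (g x); rewrite /= gK.
  - by move/continuousP: ch; apply.
  - by exists (h y); split=> //=; rewrite hK.
by apply: FX => n _; exact: Fx.
Qed.

(** Otherwise the complement of the closure would be a dense open set that
    avoids [X]. *)
Lemma nonmeager_closure X : ~ meager X -> (closure X)° !=set0.
Proof.
move=> nX; apply: contrapT => /set0P/negP; rewrite negbK => /eqP iX.
apply: nX; exists (fun _ => ~` closure X); split=> [_|x /(_ 0%N Logic.I)].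
  split; first exact/closed_openC/closed_closure.
  move=> O [x Ox] oO; apply: contrapT => /set0P/negP; rewrite negbK => /eqP OX.
  have : (closure X)° x.
    rewrite /interior nbhsE; exists O; first by split.
    move=> y Oy; apply: contrapT => nXy.
    by have : (O `&` ~` closure X) y by []; rewrite OX.
  by rewrite iX.
exact/contra_not/subset_closure.
Qed.

Lemma baire_nonmeager (x : T) : baire_space T -> ~ meager [set: T].
Proof.
move=> bT [F [/bT dF FT]].
by have [||y [_ /FT]] := dF setT; [exists x|exact: openT|apply].
Qed.

End Meager.

(** * Topological vector spaces *)

Section Tvs.
Variables (K : numFieldType) (E : tvsType K).

Lemma tvs_scaler_continuous (a : K) : continuous (fun x : E => a *: x).
Proof.
move=> x; apply: (@continuous_comp E (K^o * E)%type E
  (fun x => (a, x)) (fun z => z.1 *: z.2)); last exact: scale_continuous.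
by apply: (@cvg_pair _ _ _ _ (nbhs (a : K^o))); [exact: cvg_cst|exact: cvg_id].
Qed.

Lemma tvs_addr_continuous (x : E) : continuous (fun y : E => x + y).
Proof.
move=> y; apply: (@continuous_comp E (E * E)%type E
  (fun y => (x, y)) (fun z => z.1 + z.2)); last exact: add_continuous.
by apply: cvg_pair; [exact: cvg_cst|exact: cvg_id].
Qed.

Lemma tvs_hausdorffP : hausdorff_space E <->
  forall z : E, (forall U, nbhs (0 : E) U -> U z) -> z = 0.
Proof.
split=> [hE z z0|E0 p q pq].
  apply/esym/hE => U V U0 Vz; exists z; split; first exact: z0.
  exact: nbhs_singleton.
apply/esym/eqP; rewrite -subr_eq0; apply/eqP; apply: E0 => U U0.
(* the difference map sends a neighbourhood of [(p, q)] into the translate of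
   [U] by [p - q]; the diagonal point [(c, c)] of that neighbourhood yields
   [U (q - p)] *)
have Upq : nbhs (p - q) [set y | U (q - p + y)].
  apply: tvs_addr_continuous.
  by rewrite addrA subrK subrr.
have [[A B] [/= Ap Bq] AB] := @sub_continuous E (p, q) _ Upq.
have [c [Ac Bc]] := pq A B Ap Bq.
by have := AB (c, c) (conj Ac Bc); rewrite /= subrr addr0.
Qed.

End Tvs.

(** * Scalars, disks and gauges *)

Section Disks.
Variables (R : realType) (k : scalar_kind).
Local Notation K := (scalars R k).

Lemma scalars_archi (r : K) : 0 < r -> exists n : nat, r <= n%:R.
Proof.
case: k r => /= r r0.
  by exists (Num.truncn r).+1; exact/ltW/truncnS_gt.
case: r r0 => a b; rewrite ltcE/= => /andP[/eqP b0 a0].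
exists (Num.truncn a).+1.
rewrite -[_%:R](rmorph_nat (real_complex R)) lecE/= b0 eqxx/=.
exact/ltW/truncnS_gt.
Qed.

Lemma of_real0 : of_real k (0 : R) = 0.
Proof. by case: k. Qed.

Lemma of_real1 : of_real k (1 : R) = 1.
Proof. by case: k. Qed.

Lemma of_real_le (s t : R) : (of_real k s <= of_real k t) = (s <= t).
Proof. by case: k => //=; rewrite lecR. Qed.

Lemma of_real_lt (s t : R) : (of_real k s < of_real k t) = (s < t).
Proof. by case: k => //=; rewrite ltcR. Qed.

Lemma convex_setP (E : lmodType K) (A : set E) : convex_set A <->
  forall (x y : E) (t : {i01 K}), A x -> A y ->
    A (t%:num *: x + (1 - t%:num) *: y).
Proof.
split=> cA x y t.
  by move=> Ax Ay; have := cA x y t (mem_set Ax) (mem_set Ay) => /set_mem.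
by move=> /set_mem Ax /set_mem Ay; apply/mem_set; exact: cA.
Qed.

Lemma disk0 (E : lmodType K) (B : set E) x : disk B -> B x -> B 0.
Proof.
by move=> [_ bB] Bx; rewrite -(scale0r x); apply: bB; rewrite // normr0.
Qed.

Lemma disk_half_sub (E : lmodType K) (B : set E) x y :
  disk B -> B x -> B y -> B (2^-1 *: (x - y)).
Proof.
move=> [/convex_setP cB bB] Bx By.
have BNy : B (- y) by rewrite -scaleN1r; apply: bB; rewrite // normrN1.
have h0 : (0 : K) <= 2^-1 by rewrite invr_ge0 ler0n.
have h1 : (2^-1 : K) <= 1 by rewrite invf_le1// ler1n.
have := cB x (- y) (Itv01 h0 h1) Bx BNy.
have -> : 1 - 2^-1 = 2^-1 :> K by rewrite [X in X - _]splitr mul1r addrK.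
by rewrite -scalerDr.
Qed.

(** If [c + y] lies in the closure of [B] for all small [y], then so does
    [2^-1 *: ((c + x) - (c - x)) = x]; the argument is carried out on points of
    [B] approximating [c + x] and [c - x]. *)
Lemma disk_closure_ball (N : normedModType K) (B : set N) :
  disk B -> (closure B)° !=set0 ->
  exists2 d : K, 0 < d & forall x, `|x| < d -> closure B x.
Proof.
move=> dB [c]; rewrite /interior/= => /nbhs_normP[d /= d0 cd].
exists d => // x xd V /nbhs_normP[e /= e0 eV].
have near_B z : closure B z -> exists2 b, B b & `|z - b| < e.
  move=> /(_ _ (nbhs_ball_norm z (PosNum e0)))[b [Bb be]].
  by exists b.
have [b Bb cxb] : exists2 b, B b & `|c + x - b| < e.
  by apply: near_B; apply: cd => /=; rewrite opprD addNKr normrN.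
have [a Ba cxa] : exists2 b, B b & `|c - x - b| < e.
  by apply: near_B; apply: cd => /=; rewrite opprB addrC subrK.
exists (2^-1 *: (b - a)); split; first exact: disk_half_sub.
apply: eV => /=.
have -> : x - 2^-1 *: (b - a) = 2^-1 *: ((c + x - b) - (c - x - a)).
  rewrite -[x in LHS](scalerK (_ : (2 : K) != 0)) ?pnatr_eq0// -scalerBr.
  congr (_ *: _); rewrite scaler_nat mulr2n.
  rewrite !opprB [a + (x - c)]addrC [RHS]addrACA.
  by rewrite [c + x + _]addrC [- b + a]addrC [x - c + _]addrA subrK.
rewrite normrZ normfV normr_nat ltr_pdivrMl ?ltr0n//.
rewrite (le_lt_trans (ler_normB _ _))// mulr_natl mulr2n.
exact: ltrD.
Qed.

Lemma lin_span_sub (E : lmodType K) (B : set E) : B `<=` lin_span B.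
Proof.
move=> x Bx; exists 1%N, (fun=> 1), (fun=> x); split=> //.
by rewrite big_ord1 scale1r.
Qed.

Lemma gauge_le1 (E : lmodType K) (B : set E) x : B x -> gauge B x <= 1.
Proof.
move=> Bx; apply: ge_inf; first by exists 0 => t [/ltW].
by split=> //; exists x => //; rewrite of_real1 scale1r.
Qed.

(** The alternative [gauge B x = 0] covers the points that no multiple of [B]
    contains: there the gauge is the infimum of the empty set, which is 0. *)
Lemma gauge_lt1 (E : lmodType K) (B : set E) x : disk B -> gauge B x < 1 ->
  B x \/ gauge B x = 0.
Proof.
move=> [_ bB] gx.
pose S := [set t | 0 < t /\ [set of_real k t *: b | b in B] x].
have [S1|S0] := pselect (S !=set0).
  left; have [t [t0 [b Bb <-]] t1] := inf_lt S1 gx.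
  apply: bB => //; move: t0 t1; rewrite -!of_real_lt of_real0 of_real1.
  by move=> /ltW t0 /ltW; rewrite ger0_norm.
right; rewrite /gauge -/S; have /eqP -> : S == set0.
  by apply: contra_notT S0 => /set0P.
exact: inf0.
Qed.

Lemma disk_image (V E : lmodType K) (h : {linear V -> E}) (B : set V) :
  disk B -> disk (h @` B).
Proof.
move=> [/convex_setP cB bB]; split.
  apply/convex_setP => _ _ t [x Bx <-] [y By <-].
  exists (t%:num *: x + (1 - t%:num) *: y); first exact: cB.
  by rewrite linearD !linearZ.
by move=> a _ a1 [x Bx <-]; exists (a *: x); [exact: bB|rewrite linearZ].
Qed.

Lemma lin_span_image (V E : lmodType K) (h : {linear V -> E}) (B : set V) :
  lin_span (h @` B) = h @` lin_span B.
Proof.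
apply/seteqP; split=> x.
  move=> [n [a [b [Bb ->]]]].
  have /choice[c cP] i : exists v, B v /\ h v = b i.
    by have [v Bv vb] := Bb i; exists v.
  exists (\sum_i a i *: c i).
    by exists n, a, c; split=> // i; have [] := cP i.
  rewrite linear_sum; apply: eq_bigr => i _; rewrite linearZ.
  by have [_ ->] := cP i.
move=> [_ [n [a [b [Bb ->]]]] <-]; exists n, a, (h \o b).
split=> [i|]; first by exists (b i).
by rewrite linear_sum; apply: eq_bigr => i _; rewrite linearZ.
Qed.

Lemma gauge_image (V E : lmodType K) (h : {linear V -> E}) (B : set V) x :
  injective h -> gauge (h @` B) (h x) = gauge B x.
Proof.
move=> hI; congr inf; apply/seteqP; split=> t /= [t0].
  by move=> [_ [b Bb <-]]; rewrite -linearZ => /hI <-; split=> //; exists b.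
by move=> [b Bb <-]; split=> //; exists (h b); [exists b|rewrite linearZ].
Qed.

Lemma linear_inverse (V G : lmodType K) (h : {linear V -> G}) :
  bijective h -> exists g : {linear G -> V}, cancel h g /\ cancel g h.
Proof.
move=> [g hK gK]; have gL : linear g.
  by move=> a x y; apply: (can_inj hK); rewrite linearP !gK.
by exists (HB.pack_for {linear G -> V} g (GRing.isLinear.Build _ _ _ _ g gL)).
Qed.

Lemma tvs_boundedS (E : tvsType K) (A B : set E) :
  A `<=` B -> tvs_bounded B -> tvs_bounded A.
Proof.
move=> AB bB U /bB[r r0 rB]; exists r => // a /rB BU.
exact: subset_trans AB BU.
Qed.

Lemma tvs_bounded_image (V E : tvsType K) (h : {linear V -> E}) (B : set V) :
  continuous h -> tvs_bounded B -> tvs_bounded (h @` B).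
Proof.
move=> hc bB U U0.
have /bB[r r0 rB] : nbhs 0 (h @^-1` U) by apply: hc; rewrite linear0.
exists r => // a /rB aB _ [v /aB[w Uw <-] <-].
by exists (h w) => //; rewrite linearZ.
Qed.

(** The open unit ball of [N] is mapped into the bounded set [B], up to the
    point 0 when [B] is empty. *)
Lemma bounded_disk_continuous (G : tvsType K) (B : set G) (N : normedModType K)
    (f : {linear N -> G}) : disk B -> tvs_bounded B ->
  (forall x : N, `|x| = of_real k (gauge B (f x))) -> continuous f.
Proof.
move=> dB bB nf.
have fB x : `|x| < 1 -> B (f x) \/ f x = 0.
  rewrite nf -of_real1 of_real_lt => /(gauge_lt1 dB)[|g0]; first by left.
  right; have /eqP := nf x; rewrite g0 of_real0 normr_eq0 => /eqP ->.
  exact: linear0.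
move=> x U /= Ux.
have U0 : nbhs 0 [set y | U (f x + y)].
  by apply: tvs_addr_continuous; rewrite addr0.
have [r r0 rB] := bB _ U0.
apply/nbhs_normP; exists r^-1; first by rewrite /= invr_gt0.
move=> y /= xy; rewrite /preimage/=.
have [||B0] := fB (r *: (y - x)).
- by rewrite normrZ gtr0_norm// -ltr_pdivlMl// mulr1 distrC.
- move=> /(rB r _)[|z Uz]; first by rewrite gtr0_norm.
  rewrite linearZ/= => /(scalerI (lt0r_neq0 r0)) zE.
  by move: Uz; rewrite zE /= linearB/= addrC subrK.
- have := nbhs_singleton U0; rewrite /= addr0.
  move: B0; rewrite linearZ => /eqP.
  rewrite scaler_eq0 (negPf (lt0r_neq0 r0))/=.
  by rewrite linearB/= subr_eq0 => /eqP ->.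
Qed.

(** The same normed space witnesses that [B] and [h @` B] are Baire disks, so
    boundedness is all that has to be checked in the target. *)
Lemma baire_disk_image (V E : tvsType K) (h : {linear V -> E}) (B : set V) :
  injective h -> tvs_bounded (h @` B) -> baire_disk B -> baire_disk (h @` B).
Proof.
move=> hI bhB [dB bB [N [f [fI rf nf bN]]]]; split=> //.
  exact: disk_image.
exists N, (h \o f); split=> //.
- exact: inj_comp.
- by rewrite lin_span_image -rf image_comp.
- by move=> x; rewrite nf /= gauge_image.
Qed.

End Disks.

(** * Localization of maps from a Baire space into webbed spaces *)

Section Localization.
Variables (R : realType) (k : scalar_kind).
Local Notation K := (scalars R k).
Variables (N : normedModType K) (G : tvsType K) (f : {linear N -> G}).

Section OneSpace.
Variables (V : tvsType K) (h : {linear V -> G}).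

(** Plays the part of the preimage of [S] under [f], with [V] regarded as a
    subspace of [G] through [h]. *)
Definition pullback (S : set V) : set N :=
  [set x | exists2 w, S w & h w = f x].

Lemma pullback_disk (S : set V) : disk S -> disk (pullback S).
Proof.
move=> [/convex_setP cS bS]; split.
  apply/convex_setP => x y t [v Sv vx] [w Sw wy].
  exists (t%:num *: v + (1 - t%:num) *: w); first exact: cS.
  by rewrite !linearD !linearZ/= vx wy.
move=> a x a1 [v Sv vx]; exists (a *: v); first exact: bS.
by rewrite !linearZ/= vx.
Qed.

(** [pullback S] is covered by countably many dilates of the sets
    [pullback (T n)], and dilations preserve meagerness. *)
Lemma nonmeager_absorbed (S : set V) (T : nat -> set V) :
  (forall w, S w -> absorbs (\bigcup_n T n) [set w]) ->
  ~ meager (pullback S) -> exists n, ~ meager (pullback (T n)).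
Proof.
move=> absT nS; apply: contrapT => /forallNP mT; apply: nS.
pose X (p : nat * nat) : set N :=
  (fun x => (p.2.+1%:R : K)^-1 *: x) @^-1` pullback (T p.1).
have mX p : meager (X p).
  have p0 : (p.2.+1%:R : K) != 0 by rewrite pnatr_eq0.
  apply: (@meager_preimage _ _ (fun x => (p.2.+1%:R : K) *: x)).
  - exact: tvs_scaler_continuous.
  - exact: tvs_scaler_continuous.
  - by move=> x; rewrite scalerA divff// scale1r.
  - by move=> x; rewrite scalerA mulVf// scale1r.
  - by have /contrapT := mT p.1.
apply: meager_sub (meager_bigcup mX) => x [w Sw hw].
have [r r0 absr] := absT w Sw.
have [n rn] := scalars_archi r0.
have [|y [i _ Ty] yw] := absr (n.+1%:R) _ w erefl.
  by rewrite normr_nat (le_trans rn)// ler_nat.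
exists (i, n) => //; exists y => //=.
by rewrite linearZ/= -hw -yw linearZ/= scalerA mulVf ?pnatr_eq0// scale1r.
Qed.

(** The indices of the strand are chosen one after the other, the absorption
    axioms of the web keeping the pullback nonmeager; the empty sequence, whose
    web set is irrelevant, stands for the whole space [V]. *)
Lemma nonmeager_strand (W : seq nat -> set V) : web W ->
  ~ meager (pullback setT) ->
  exists u, forall m, (0 < m)%N -> ~ meager (pullback (strand W u m)).
Proof.
move=> [_ W1 _ Wn] nT.
have step (s : seq nat) : exists n, s = [::] \/ ~ meager (pullback (W s)) ->
    ~ meager (pullback (W (rcons s n))).
  have [[->|ns]|bad] := pselect (s = [::] \/ ~ meager (pullback (W s))).
  - have [n Hn] := nonmeager_absorbed (fun w _ => W1 w) nT.
    by exists n.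
  - have [s0|s0] := eqVneq s [::].
      have [n Hn] := nonmeager_absorbed (fun w _ => W1 w) nT.
      by exists n; rewrite s0.
    by have [n Hn] := nonmeager_absorbed (Wn s s0) ns; exists n.
  - by exists 0%N.
have [next nextP] := choice step.
pose S := fix S m := if m is m'.+1 then rcons (S m') (next (S m')) else [::].
have SE m : mkseq (fun i => next (S i)) m = S m.
  by elim: m => //= m IH; rewrite mkseqS IH.
exists (fun i => next (S i)); case=> // m _; rewrite /strand SE.
elim: m => [|m IH]; first by apply: (nextP [::]); left.
by apply: (nextP (S m.+1)); right.
Qed.

Hypotheses (f_cont : continuous f) (h_cont : continuous h)
  (G_hausdorff : hausdorff_space G).

(** Closures can be dropped at the cost of one index: strictness of the web
    lets the successive approximations of [x] by points of the pullbacks be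
    summed. *)
Lemma pullback_ball (W : seq nat -> set V) (u : nat -> nat) : strict_web W ->
  (forall m, (0 < m)%N -> ~ meager (pullback (strand W u m))) ->
  exists r : nat -> K, (forall m, 0 < r m) /\
   forall n, (0 < n)%N -> forall x, `|x| < r n.+1 -> pullback (strand W u n) x.
Proof.
move=> [[Wdisk _ _ _] _ Wsum] nm.
have sdisk m : (0 < m)%N -> disk (strand W u m).
  by move=> m0; apply: Wdisk; rewrite -size_eq0 size_mkseq -lt0n.
(* the bound [m%:R^-1] forces the remainders of the approximation to 0 *)
have exr m : exists r : K, [/\ 0 < r, r <= m%:R^-1 \/ m = 0%N &
    (0 < m)%N -> forall x, `|x| < r -> closure (pullback (strand W u m)) x].
  have [->|m0] := posnP m; first by exists 1; split=> //; right.
  have [d d0 dcl] := disk_closure_ball (pullback_disk (sdisk m m0))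
     (nonmeager_closure (nm m m0)).
  have m1 : 0 < (m%:R^-1 : K) by rewrite invr_gt0 ltr0n.
  have /orP[dm|md] := real_leVge (gtr0_real d0) (gtr0_real m1).
    by exists d; split=> //; left.
  exists m%:R^-1; split=> //; first by left.
  by move=> _ x xm; apply: dcl; exact: lt_le_trans md.
have [r rP] := choice exr.
have r0 m : 0 < r m by have [] := rP m.
exists r; split=> [m|n n0 x xr]; first exact: r0.
(* a remainder [p.2] smaller than [r p.1] lies in the closure of the pullback of
   index [p.1], so it can be approximated there up to the next radius *)
have exw p : exists q : N * V, (0 < p.1)%N -> `|p.2| < r p.1 ->
   [/\ strand W u p.1 q.2, h q.2 = f q.1 & `|p.2 - q.1| < r p.1.+1].
  case: p => m z /=.
  have [zr|zr] := pselect ((0 < m)%N /\ `|z| < r m); last first.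
    by exists (0, 0) => m0 zm; case: zr.
  have [_ _ /(_ zr.1 z zr.2)] := rP m.
  move=> /(_ _ (nbhs_ball_norm z (PosNum (r0 m.+1))))[y [[v Wv vy] zy]].
  by exists (y, v).
have [q qP] := choice exw.
(* [z i] is the remainder of [x] after [i] steps, the first of which uses the
   web set of index [n.+1]; [w] lists the lifts to [V] of the successive
   approximations, padded with 0 up to index [n] *)
pose z := fix z i := if i is i'.+1 then z i' - (q (n.+1 + i', z i')%N).1 else x.
have zr i : `|z i| < r (n.+1 + i)%N.
  elim: i => [|i IH] /=; first by rewrite addn0.
  by have [|//|] := qP ((n.+1 + i)%N, z i); rewrite //= addnS.
pose w m : V := if (m <= n)%N then 0 else (q (m, z (m - n.+1)%N)).2.
have wP i : strand W u (n.+1 + i) (w (n.+1 + i)%N) /\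
    h (w (n.+1 + i)%N) = f (z i - z i.+1).
  have [//||/= H1 H2 H3] := qP ((n.+1 + i)%N, z i); first exact: zr.
  rewrite /w ifN ?addKn; last by rewrite -ltnNge leq_addr.
  by rewrite subKr.
have s0 m : (0 < m)%N -> strand W u m 0.
  move=> m0; have [x0 [w0 sw0 _]] := nonmeager_nonempty (nm m m0).
  exact: disk0 (sdisk m m0) sw0.
have wW m : (0 < m)%N -> strand W u m (w m).
  move=> m0; have [mn|mn] := leqP m n; last first.
    by rewrite -(subnKC mn); have [] := wP (m - n.+1)%N.
  by rewrite /w mn; exact: s0.
have [_ /(_ n n0) [l wl sl]] := Wsum u w wW.
exists l => //.
have part M : h (\sum_(n.+1 <= m < n.+1 + M) w m) = f (x - z M).
  elim: M => [|M IH]; first by rewrite addn0 big_geq// subrr !linear0.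
  rewrite addnS big_nat_recr ?leq_addr//= linearD/= IH (wP M).2 -linearD/=.
  by rewrite addrA subrK.
have z0 : z i @[i --> \oo] --> (0 : N).
  apply/cvgr0Pnorm_lt => e e0.
  have [M Me] := scalars_archi (divr_gt0 ltr01 e0).
  exists M.+1 => //= i Mi; apply: lt_le_trans (zr i) _.
  have [_ [rn|//] _] := rP (n.+1 + i)%N.
  apply: le_trans rn _; rewrite -[e]invrK lef_pV2 ?posrE ?ltr0n ?invr_gt0//.
  rewrite -div1r (le_trans Me)// ler_nat.
  by rewrite (leq_trans (leqnSn M))// (leq_trans Mi)// leq_addl.
have c1 : h (\sum_(n.+1 <= m < M + n.+1) w m) @[M --> \oo] --> h l.
  apply: (@continuous_cvg _ _ _ _ _ _ h l); first exact: h_cont.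
  by apply: cvg_comp wl; exact: cvg_addnr.
have c2 : h (\sum_(n.+1 <= m < M + n.+1) w m) @[M --> \oo] --> f x.
  have -> : (fun M => h (\sum_(n.+1 <= m < M + n.+1) w m)) =
      (fun M => f (x - z M)).
    by apply/funext => M; rewrite addnC part.
  apply: (@continuous_cvg _ _ _ _ _ (fun M => x - z M) f x).
    exact: f_cont.
  rewrite -[X in _ --> X]subr0; apply: cvgB => //; exact: cvg_cst.
exact: (cvg_unique G_hausdorff c1 c2).
Qed.

End OneSpace.

(** The conclusion says that [f] takes its values in [V m] and is continuous at
    0 for the topology of [V m]: for an arbitrary [x], apply it to a small
    multiple of [x]. *)
Lemma localization (V : nat -> tvsType K) (h : forall n, {linear V n -> G}) :
  continuous f -> hausdorff_space G -> baire_space N ->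
  (forall n, continuous (h n)) -> (forall n, strictly_webbed (V n)) ->
  range f `<=` \bigcup_n range (h n) ->
  exists m, forall U : set (V m), nbhs 0 U ->
    exists2 d : K, 0 < d & forall x, `|x| < d -> pullback (h m) U x.
Proof.
move=> f_cont hG bN h_cont webV fh.
have [m nm] : exists m, ~ meager (pullback (h m) setT).
  apply: contrapT => /forallNP mV; apply: (baire_nonmeager (0 : N) bN).
  apply: (@meager_sub _ _ (\bigcup_m pullback (h m) setT)) => [x _|].
    by have [m _ [v _ vx]] := fh (f x) (imageT _ _); exists m => //; exists v.
  by apply: meager_bigcup => m; exact: contrapT (mV m).
have [W sW] := webV m; have [webW compW _] := sW.
have [u nu] := nonmeager_strand webW nm.
have [r [r0 rW]] := pullback_ball f_cont (@h_cont m) hG sW nu.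
exists m => U U0; have [n n0 nU] := compW u U U0.
exists (r n.+1) => // x /(rW n n0)[v Wv vx].
by exists v => //; exact: nU.
Qed.

End Localization.

Section BaireDisks.
Variables (R : realType) (k : scalar_kind).
Local Notation K := (scalars R k).

(** The disk [B] lies in the image of the closed unit ball of its normed space,
    which by localization is absorbed by every neighbourhood of 0 in [V m]. *)
Lemma baire_disk_localized (G : tvsType K) (V : nat -> tvsType K)
    (h : forall n, {linear V n -> G}) (B : set G) :
  hausdorff_space G -> (forall n, continuous (h n)) ->
  (forall n, injective (h n)) ->
  (forall n, strictly_webbed (V n)) -> \bigcup_n range (h n) = setT ->
  baire_disk B ->
  exists m, B `<=` range (h m) /\ tvs_bounded (h m @^-1` B).
Proof.
move=> hG hc hI webV hT [dB bB [N [f [fI rf nf bN]]]].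
have fc := bounded_disk_continuous dB bB nf.
have [|m mP] := localization fc hG bN hc webV; first by rewrite hT.
exists m.
have Bf y : B y -> exists2 x, `|x| <= 1 & f x = y.
  move=> By; have : range f y by rewrite rf; exact: lin_span_sub.
  move=> [x _ xy]; exists x => //.
  by rewrite nf xy -of_real1 of_real_le gauge_le1.
have mB U : nbhs 0 U -> exists2 r : K, 0 < r & forall a y, r <= `|a| ->
   B y -> exists2 v, U v & h m (a *: v) = y.
  move=> /mP[d d0 dU]; exists (2 / d); first by rewrite divr_gt0.
  move=> a y ra /Bf[x x1 <-].
  have a0 : 0 < `|a| by apply: lt_le_trans ra; rewrite divr_gt0.
  have a0' : a != 0 by rewrite -normr_gt0.
  have [|v Uv vE] := dU (a^-1 *: x).
    rewrite normrZ normfV ltr_pdivrMl//.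
    apply: le_lt_trans x1 _; rewrite -ltr_pdivrMr//.
    by apply: lt_le_trans ra; rewrite ltr_pM2r ?invr_gt0// ltr1n.
  by exists v => //; rewrite linearZ/= vE linearZ/= scalerA divff// scale1r.
split=> [y By|U U0].
  have [r r0 rB] := mB setT filterT.
  have [|v _ <-] := rB r y _ By; first by rewrite gtr0_norm.
  by exists (r *: v).
have [r r0 rB] := mB U U0; exists r => // a ra v /(rB a _ ra)[w Uw /hI <-].
by exists w.
Qed.

(** The closure [Z] of 0 is a bounded subspace, so by regularity it is a bounded
    subspace of some [V m]; in a Hausdorff space such a subspace is trivial. *)
Lemma regular_hausdorff (V : nat -> tvsType K) (E : tvsType K)
    (j : forall n, {linear V n -> E}) :
  (forall n, hausdorff_space (V n)) -> regular_limit j -> hausdorff_space E.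
Proof.
move=> hV regj; pose Z := [set z : E | forall U, nbhs 0 U -> U z].
have ZZ a z : Z z -> Z (a *: z).
  move=> Zz U U0; apply: (Zz [set x | U (a *: x)]).
  by apply: tvs_scaler_continuous; rewrite scaler0.
have bZ : tvs_bounded Z.
  move=> U U0; exists 1 => // a a1 z Zz.
  have a0 : a != 0 by rewrite -normr_gt0 (lt_le_trans ltr01).
  by exists (a^-1 *: z); [exact: ZZ Zz U U0|rewrite scalerA divff// scale1r].
have [m [Zm bm]] := regj Z bZ.
apply/tvs_hausdorffP => z Zz; have [v _ vz] := Zm z Zz.
rewrite -vz; suff -> : v = 0 by rewrite linear0.
have /tvs_hausdorffP := hV m; apply => U /bm[r r0 rZ].
have [||u Uu /(scalerI (lt0r_neq0 r0)) <- //] := rZ r _ (r *: v).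
- by rewrite gtr0_norm.
- by rewrite /= linearZ vz; exact: ZZ.
Qed.

End BaireDisks.

(** * Regularity and local Baireness of inductive limits *)

Theorem theorem1 (R : realType) (k : scalar_kind)
  (En : nat -> tvsType (scalars R k))
  (En_hausdorff : forall n, hausdorff_space (En n))
  (i : forall n, {linear En n -> En n.+1})
  (i_continuous : forall n, continuous (i n))
  (E : tvsType (scalars R k))
  (j : forall n, {linear En n -> E})
  (j_injective : forall n, injective (j n))
  (j_compatible : forall n (x : En n), j n.+1 (i n x) = j n x)
  (E_union : \bigcup_n range (j n) = [set: E])
  (E_limit : inductive_limit_topology j)
  (En_webbed : forall n, strictly_webbed (En n)) :
  (quasi_locally_baire E -> regular_limit j) /\
  ((forall n, quasi_locally_baire (En n)) -> regular_limit j ->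
     locally_baire E).
Proof.
have [jc _] := E_limit; split=> [[_ qE] A bA|qEn regj].
  have [rho [hrho crho [B bB AB]]] := qE A bA.
  have idI : injective (lct_id rho) := bij_inj (lct_bij rho).
  pose h n : {linear En n -> lct_space rho} := lct_id rho \o j n.
  have [|||m [Bm bm]] :=
    @baire_disk_localized _ _ _ _ h B hrho _ _ En_webbed _ bB.
  - by move=> n x; apply: continuous_comp; [exact: jc|exact: crho].
  - by move=> n; exact: inj_comp.
  - apply/seteqP; split=> // y _; have [g gK Kg] := lct_bij rho.
    have : (\bigcup_n range (j n)) (g y) by rewrite E_union.
    by move=> [n _ [v _ vy]]; exists n => //; exists v => //=; rewrite vy Kg.
  exists m; split=> [x Ax|].
    have [|v _ vx] := Bm (lct_id rho x); first by apply: AB; exists x.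
    by exists v => //; exact: idI.
  by apply: tvs_boundedS bm => v Av; apply: AB; exists (j m v).
split; first exact: regular_hausdorff En_hausdorff regj.
move=> A bA; have [m [Am bm]] := regj A bA.
have [_ /(_ _ bm)[rho [hrho crho [B bB AB]]]] := qEn m.
have [g [idK gK]] := linear_inverse (lct_bij rho).
have [|_ [_ bidB]] := @baire_disk_localized _ _ _ (fun=> En m)
  (fun=> lct_id rho) B hrho (fun=> crho) (fun=> can_inj idK)
  (fun=> En_webbed m) _ bB.
  by apply/seteqP; split=> // y _; exists 0%N => //; exists (g y).
have idB : lct_id rho @^-1` B = g @` B.
  apply/seteqP; split=> v; first by move=> Bv; exists (lct_id rho v).
  by move=> [b Bb <-]; rewrite /= gK.
exists (j m @` (g @` B)).
  rewrite idB in bidB; apply: baire_disk_image => //.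
    exact: tvs_bounded_image.
  by apply: baire_disk_image => //; exact: can_inj gK.
move=> x Ax; have [v _ vx] := Am x Ax; exists v => //.
rewrite -idB; apply: AB; exists v => //.
by rewrite /= vx.
Qed.
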